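(* Fix a real number $k>1$. For each integer $n\ge 4$, let $s_n$ be a number such that $B_n(s_n)$ is optimal in $\mathcal{B}_n$, the family of all bridges of order $n+2$. Then for $n$ sufficiently large (depending on $k$), $$\frac{n^{2/3}}{k}<s_n<n^{2/3}.$$ In particular, $s_n$ grows asymptotically like $n^{2/3}$, i.e. $s_n/n^{2/3}\to 1$ as $n\to\infty$.
   Context: The order of a graph is its number of vertices. A subtree of a tree $T$ is a nonempty connected subgraph. The mean subtree order $M_T$ is the average of the orders of all subtrees of $T$. A tree of maximum mean subtree order in a given family is called optimal in that family. For integers $s\ge 1$ and $t\ge 0$, the $(s,t)$-bridge $B(s,t)$ is the tree of order $4s+t+2$ obtained by joining the central vertices of two paths of order $2s+1$ by a path of order $t$ (each end of this path is made adjacent to one of the two central vertices; if $t=0$, the two central vertices are simply joined by an edge). For integers $n,s$ with $1\le s\le\frac n4$, put $B_n(s)=B(s,n-4s)$, a tree of order $n+2$, and let $\mathcal{B}_n=\{B_n(s): s\in\mathbb{N},\ 1\le s\le \frac n4\}$ be the set of all bridges of order $n+2$. *)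

(* Defs.v *)
From HB Require Import structures.
From mathcomp Require Import all_boot all_order all_algebra.
Set Implicit Arguments.
Unset Strict Implicit.
Unset Printing Implicit Defensive.
Import Order.TTheory GRing.Theory Num.Theory.

Record sgraph := SGraph {
  vertex : finType;
  adj : rel vertex;
  adj_sym : symmetric adj;
  adj_irr : irreflexive adj }.

Definition edges (G : sgraph) : {set {set vertex G}} :=
  [set [set p.1; p.2] | p : vertex G * vertex G & adj p.1 p.2].

(* A subgraph is a pair H = (vertex set, edge set), not necessarily induced.
   Since the edges of H have their ends in H.1, a walk along H.2 that starts
   in H.1 stays in H.1. *)
Definition is_subgraph (G : sgraph)
    (H : {set vertex G} * {set {set vertex G}}) : bool :=
  (H.2 \subset edges G) && [forall e in H.2, e \subset H.1].

Definition is_connected (G : sgraph)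
    (H : {set vertex G} * {set {set vertex G}}) : bool :=
  [forall x in H.1, forall y in H.1,
     connect (fun u v => [set u; v] \in H.2) x y].

Definition subtrees (G : sgraph) :
    {set {set vertex G} * {set {set vertex G}}} :=
  [set H | [&& is_subgraph H, H.1 != set0 & is_connected H]].

Definition mean_subtree_order (G : sgraph) : rat :=
  ((\sum_(H in subtrees G) #|H.1|)%N%:R / #|subtrees G|%:R)%R.

Definition optimal (F : sgraph -> Prop) (G : sgraph) :
    Prop :=
  F G /\ forall H, F H -> (mean_subtree_order H <= mean_subtree_order G)%R.

Definition consecutive (i j : nat) : bool := (i.+1 == j) || (j.+1 == i).

(* inl (b, i) is the i-th vertex of the b-th path of order 2s+1, whose central
   vertex has index s; inr k is the k-th vertex of the connecting path, whose
   first vertex is attached to path false and last vertex to path true. *)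
Definition bridge_vertex (s t : nat) : finType :=
  ((bool * 'I_(2 * s + 1)) + 'I_t)%type.

Definition attached (s t : nat) (x : bool * 'I_(2 * s + 1)) (k : 'I_t) : bool :=
  (x.2 == s :> nat) && (if x.1 then k.+1 == t else k == 0 :> nat).

Definition bridge_adj (s t : nat) : rel (bridge_vertex s t) := fun u v =>
  match u, v with
  | inl x, inl y =>
      if x.1 == y.1 then consecutive x.2 y.2
      else [&& t == 0, x.2 == s :> nat & y.2 == s :> nat]
  | inl x, inr k | inr k, inl x => attached x k
  | inr k, inr l => consecutive k l
  end.

Lemma consecutive_sym : symmetric consecutive.
Proof. by move=> i j; rewrite /consecutive orbC. Qed.

Lemma consecutive_irr : irreflexive consecutive.
Proof. by move=> i; rewrite /consecutive orbb gtn_eqF. Qed.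

Lemma bridge_adj_sym (s t : nat) : symmetric (@bridge_adj s t).
Proof.
move=> [x|k] [y|l] //=; last exact: consecutive_sym.
by rewrite eq_sym consecutive_sym [X in _ && X]andbC.
Qed.

Lemma bridge_adj_irr (s t : nat) : irreflexive (@bridge_adj s t).
Proof. by move=> [x|k] /=; rewrite ?eqxx consecutive_irr. Qed.

Definition bridge (s t : nat) : sgraph :=
  SGraph (@bridge_adj_sym s t) (@bridge_adj_irr s t).

Lemma card_bridge (s t : nat) : #|vertex (bridge s t)| = 4 * s + t + 2.
Proof.
rewrite /= card_sum card_prod card_bool !card_ord mulnDr mulnA muln1.
by rewrite addnAC.
Qed.

Definition bridge_of_order (n s : nat) : sgraph := bridge s (n - 4 * s).

Definition admissible (n s : nat) : bool := (1 <= s)%N && (4 * s <= n)%N.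

Definition bridges (n : nat) (G : sgraph) : Prop :=
  exists2 s : nat, admissible n s & G = bridge_of_order n s.

Definition optimal_sequence (s : nat -> nat) : Prop :=
  forall n, (4 <= n)%N ->
    admissible n (s n) /\ optimal (bridges n) (bridge_of_order n (s n)).

(* Main.v *)
Require Import Defs.
From mathcomp Require Import all_boot all_order all_algebra.
From mathcomp Require Import zify ring lra.
Import Order.TTheory GRing.Theory Num.Theory.
Local Open Scope ring_scope.
Set Implicit Arguments.
Unset Strict Implicit.
Unset Printing Implicit Defensive.

(** Let [a = s + 1]. There are [a ^ 2] subtrees of a path of order [2 s + 1] through
    its centre, of mean order [a]. So the bridge of order [n + 2] has [a ^ 4]
    subtrees through both centres, of mean order [n + 4 - 2 a], and about
    [2 n a ^ 2] subtrees through one centre only, which fall short of this order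
    by about [n / 2] on average; when [a] is well above the square root of [n]
    the former dominate, and the mean subtree order is about
    [n + 4 - (2 a + n ^ 2 / a ^ 2)]. The bracket is minimal at [a = n ^ (2/3)].

    To make this precise, subtrees are counted exactly. In a rooted forest every
    subtree has a highest vertex [v], and the generating function of the
    subtrees with top [v], by order, is ['X] times the product of one plus the
    generating functions of the children of [v] ([top_gf_rec]). For a bridge
    rooted at one of its centres this gives the generating function in closed
    form ([sum_gf]), and its value and derivative at 1 yield the mean as a
    quotient of two polynomials in [s] and [t] ([mean_bridge]).

    The parameters [s] and [s + 1] are then compared at fixed order, which is a
    polynomial inequality. Below [n ^ (2/3)] by a constant factor the mean
    increases with [s] ([mean_increasing]): the dominant terms of the polynomial
    decide, uniformly down to [s = 1]. From [n ^ (2/3)] on it decreases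
    ([mean_decreasing]): there the dominant terms may cancel, but the terms of
    the next order have the right sign, which is why the upper bound on the
    optimal [s] holds without any constant factor. An optimal [s] can lie in
    neither range, and letting [k] tend to 1 gives the limit. *)

(** * Subtrees of a forest with a height function *)

(** A rooted forest is presented by a height function [rk] on the vertices: the
    ends of an edge have distinct heights, and a vertex has at most one
    neighbour of smaller height, its parent. Keeping the graph itself, instead
    of a parent function, lets the adjacency of a concrete graph be used as it
    is. *)
Section RankedForest.

Variables (G : sgraph) (rk : vertex G -> nat).
Hypothesis rk_adj : forall u v, adj u v -> rk u != rk v.
Hypothesis rk_uniq : forall u v w, adj u v -> adj u w ->
  (rk v < rk u)%N -> (rk w < rk u)%N -> v = w.

Implicit Types (u v w x y z c : vertex G) (X Y : {set vertex G}).

Definition parent : rel (vertex G) := fun u v => adj u v && (rk v < rk u)%N.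

Lemma parent_adj u v : adj u v = parent u v || parent v u.
Proof.
rewrite /parent adj_sym -andb_orr -neq_ltn; case: (boolP (adj v u)) => //= a.
by rewrite rk_adj.
Qed.

Lemma parent_rk u v : parent u v -> (rk v < rk u)%N.
Proof. by case/andP. Qed.

Lemma parent_uniq u v w : parent u v -> parent u w -> v = w.
Proof. by move=> /andP[a r] /andP[a' r']; apply: (rk_uniq a a'). Qed.

Definition below c z := connect parent z c.

Lemma connect_step (T : finType) (e : rel T) (x y : T) :
  connect e x y -> x = y \/ exists2 z, e x z & connect e z y.
Proof.
case/connectP=> -[|z p] /= ; first by move=> _ ->; left.
case/andP=> exz ezp ->; right; exists z => //.
by apply/connectP; exists p.
Qed.

Lemma below_up c y z : below c y -> y != c -> parent y z -> below c z.
Proof.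
move=> cy ney yz; case: (connect_step cy) => [eyc|[w yw wc]].
  by rewrite eyc eqxx in ney.
by rewrite (parent_uniq yz yw).
Qed.

Lemma below_down c y z : parent y z -> below c z -> below c y.
Proof. by move=> yz; apply/connect_trans/connect1. Qed.

Lemma below_rk c z : below c z -> (rk c <= rk z)%N.
Proof.
case/connectP=> p; elim: p z => [|y p IH] z /=; first by move=> _ ->.
by case/andP=> zy /IH h /h r; apply: leq_trans r (ltnW (parent_rk zy)).
Qed.

(** Parents being unique, the ancestors of [z] form a chain. *)
Lemma below_total c d z : below c z -> below d z -> below c d || below d c.
Proof.
case/connectP=> p; elim: p z => [|y p IH] z /=; first by move=> _ -> ->; rewrite orbT.
case/andP=> zy yp ec dz; case: (eqVneq z d) => [<-|nzd].
  by rewrite (_ : below c z) //; apply/connectP; exists (y :: p); rewrite //= zy.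
exact: IH yp ec (below_up dz nzd zy).
Qed.

Lemma below_child v y : below v y -> y != v -> exists2 c, parent c v & below c y.
Proof.
case/connectP=> p; elim: p y => [|z p IH] y /=; first by move=> _ ->; rewrite eqxx.
case/andP=> yz zp ev _; case: (eqVneq z v) => [<-|nzv].
  by exists y => //; apply: connect0.
by have [c cv cz] := IH z zp ev nzv; exists c => //; apply: below_down cz.
Qed.

Lemma child_above c v : parent c v -> ~~ below c v.
Proof. by move/parent_rk => r; apply/negP => /below_rk; rewrite leqNgt r. Qed.

Lemma below_sibling c d v z : parent c v -> parent d v ->
  below c z -> below d z -> c = d.
Proof.
move=> cv dv cz dz; apply/eqP; apply: contraT => ncd.
by case/orP: (below_total cz dz) => b;
  [case/negP: (child_above cv)|case/negP: (child_above dv)];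
  apply: below_up b _ _ => //; rewrite eq_sym.
Qed.

(** The vertex sets of the subtrees whose highest vertex is [v]: every other
    vertex brings its parent along, so that climbing from any vertex of [X]
    ends at [v]. *)
Definition topped v X :=
  (v \in X) && [forall y in X, (y != v) ==> [exists z in X, parent y z]].

Lemma toppedP v X :
  reflect (v \in X /\ forall y, y \in X -> y != v -> exists2 z, z \in X & parent y z)
          (topped v X).
Proof.
apply: (iffP andP) => -[vX H]; split=> //.
  move=> y yX nyv; move/forall_inP/(_ y yX)/implyP/(_ nyv): H.
  by case/exists_inP=> z; exists z.
apply/forall_inP=> y yX; apply/implyP=> nyv.
by have [z zX yz] := H y yX nyv; apply/exists_inP; exists z.
Qed.

Lemma topped_below v X y : topped v X -> y \in X -> below v y.
Proof.
move=> /toppedP[vX H]; have [n] := ubnP (rk y); elim: n y => // n IH y ryn yX.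
case: (eqVneq y v) => [->|nyv]; first exact: connect0.
have [z zX yz] := H y yX nyv; apply: below_down (yz) _.
by apply: IH zX; apply: leq_trans (parent_rk yz) _.
Qed.

Lemma topped_uniq v w X : topped v X -> topped w X -> v = w.
Proof.
move=> tv tw; apply/eqP; apply: contraT => nvw.
have [wX _] := toppedP _ _ tw; have [vX _] := toppedP _ _ tv.
have [z zX /parent_rk r] := (toppedP _ _ tw).2 v vX nvw.
by have := below_rk (topped_below tv zX); rewrite leqNgt r.
Qed.

(** In a forest a subtree has no choice of edges: it must carry all the edges
    between its vertices. *)
Definition induced X : {set vertex G} * {set {set vertex G}} :=
  (X, [set [set p.1; p.2] | p : vertex G * vertex G &
        [&& p.1 \in X, p.2 \in X & adj p.1 p.2]]).

Lemma set2_inj u v (a b : vertex G) :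
  [set u; v] = [set a; b] -> u = a /\ v = b \/ u = b /\ v = a.
Proof.
move=> E; have := set21 a b; have := set22 a b; rewrite -E.
have := set22 u v; have := set21 u v; rewrite {1 2}E !inE.
by do 4![case/orP => /eqP ?]; subst; auto.
Qed.

Lemma mem_edges u v : ([set u; v] \in edges G) = adj u v.
Proof.
apply/imsetP/idP => [[[a b]]|a]; last by exists (u, v); rewrite ?inE.
by rewrite inE /= => ab /set2_inj[] [-> ->] //; rewrite adj_sym.
Qed.

Lemma mem_induced X u v :
  ([set u; v] \in (induced X).2) = [&& u \in X, v \in X & adj u v].
Proof.
apply/imsetP/idP => [[[a b]]|a]; last by exists (u, v); rewrite ?inE.
rewrite inE /= => /and3P[aX bX ab] /set2_inj[] [-> ->]; first by apply/and3P.
by rewrite adj_sym; apply/and3P.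
Qed.

Lemma topped_subtree v X : topped v X -> induced X \in subtrees G.
Proof.
move=> tX; have [vX H] := toppedP _ _ tX.
rewrite inE; apply/and3P; split; last 1 first.
- set e := (fun u w : vertex G => [set u; w] \in (induced X).2).
  have esym : connect_sym e by apply: sym_connect_sym => a b; rewrite /e setUC.
  suff tov y : y \in X -> connect e y v.
    apply/forall_inP=> x xX; apply/forall_inP=> y yX.
    by apply: (connect_trans (tov x xX)); rewrite esym; apply: tov.
  have [n] := ubnP (rk y); elim: n y => // n IH y ryn yX.
  case: (eqVneq y v) => [->|nyv]; first exact: connect0.
  have [z zX yz] := H y yX nyv.
  apply: (connect_trans (connect1 _)) (IH z _ zX).
    by rewrite /e mem_induced yX zX parent_adj yz.
  by apply: leq_trans (parent_rk yz) _.
- rewrite /is_subgraph; apply/andP; split.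
    apply/fintype.subsetP=> _ /imsetP[[a b] + ->]; rewrite inE /= => /and3P[_ _ ab].
    by rewrite mem_edges.
  apply/forall_inP=> _ /imsetP[[a b] + ->]; rewrite inE /= => /and3P[aX bX _].
  by apply/fintype.subsetP => c; rewrite !inE => /orP[]/eqP->.
- by apply/set0Pn; exists v.
Qed.

(** The top is a vertex [v] of minimal height. The descendants of another
    vertex [y] do not contain [v], and the only edge that leaves them is the one
    from [y] to its parent; a walk from [y] to [v] inside the subtree has to use
    that edge. Hence the subtree contains every parent edge below [v], and
    these are all the edges between its vertices. *)
Lemma subtree_topped H : H \in subtrees G ->
  exists v, topped v H.1 /\ H = induced H.1.
Proof.
case: H => X E; rewrite inE /= => /and3P[/andP[/= EG EX] /set0Pn[x0 x0X] con].
pose v := [arg min_(i < x0 in X) rk i].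
have [vX vmin] : v \in X /\ forall y, y \in X -> (rk v <= rk y)%N.
  by rewrite /v; case: arg_minnP.
have ends a b : [set a; b] \in E -> a \in X /\ b \in X.
  by move/(forall_inP EX)/fintype.subsetP => s; split; apply: s; rewrite !inE eqxx ?orbT.
have up y : y \in X -> y != v -> exists2 z, [set y; z] \in E & parent y z.
  move=> yX nyv; apply/exists_inP; apply: contraT => /exists_inPn none.
  have /connectP[p] := forall_inP (forall_inP con y yX) v vX.
  (* The walk starts at y, so as long as it avoids the parent edge of y it
     remains among the descendants of y. *)
  have : below y y by apply: connect0.
  elim: p {2 3 4}y => [|w p IH] u /= yu.
    move=> _ ev; have [uv|[z vz zy]] := connect_step yu.
      by move: nyv; rewrite ev uv eqxx.
    have := leq_ltn_trans (below_rk zy) (parent_rk vz).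
    by rewrite -ev ltnNge vmin.
  case/andP=> uwE wp ev; apply: (IH w _ wp ev).
  have : adj u w by rewrite -mem_edges; apply: (fintype.subsetP EG).
  rewrite parent_adj => /orP[uw|wu]; last exact: below_down yu.
  case: (eqVneq u y) => [uy|nuy]; last exact: below_up yu _ uw.
  by have := none w; rewrite -uy unfold_in uwE uw => /(_ isT).
exists v; split.
  apply/toppedP; split=> // y yX nyv; have [z yzE yz] := up y yX nyv.
  by exists z => //; case: (ends _ _ yzE).
congr (_, _); apply/setP=> e; apply/idP/imsetP.
  move=> eE; have /imsetP[[a b] + ee] := fintype.subsetP EG e eE.
  rewrite inE /= => ab; exists (a, b) => //; rewrite inE /=.
  by rewrite ee in eE; case: (ends _ _ eE) => -> ->.
case=> -[a b]; rewrite inE /= => /and3P[aX bX ab] ->.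
wlog pab : a b aX bX ab / parent a b.
  move=> W; move: (ab); rewrite parent_adj => /orP[] p; first exact: W.
  by rewrite setUC; apply: W => //; rewrite adj_sym.
have nav : a != v.
  by apply: contraTneq (parent_rk pab) => ->; rewrite -leqNgt vmin.
by have [z azE az] := up a aX nav; rewrite (parent_uniq pab az).
Qed.

Lemma sum_subtrees (V : nmodType) (f : nat -> V) :
  \sum_(H in subtrees G) f #|H.1| = \sum_v \sum_(X | topped v X) f #|X|.
Proof.
rewrite pair_big_dep /=.
pose D := [set p : vertex G * {set vertex G} | topped p.1 p.2].
have -> : subtrees G = [set induced p.2 | p in D].
  apply/setP=> H; apply/idP/imsetP => [/subtree_topped[v [tv eH]]|[[v X]]].
    by exists (v, H.1) => //; rewrite inE.
  by rewrite inE /= => tv ->; apply: topped_subtree tv.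
rewrite big_imset /=.
  by apply: eq_bigl => p; rewrite inE.
move=> [v X] [w Y]; rewrite !inE /= => tv tw [eXY _].
by rewrite eXY in tv *; rewrite (topped_uniq tv tw).
Qed.

(** Subtrees are weighted by ['X ^ order], so that the value of the generating
    function at 1 counts them and the value of its derivative at 1 adds up their
    orders. *)
Definition top_gf v : {poly rat} := \sum_(X | topped v X) 'X^#|X|.

(** A subtree with top [v] amounts to the choice, for every child [c] of [v], of
    nothing or of a subtree with top [c]; [graft] and [branches] are the two
    directions of this bijection. *)
Definition graft v (f : {ffun vertex G -> {set vertex G}}) : {set vertex G} :=
  v |: \bigcup_(c | parent c v) f c.

Definition branches v X : {ffun vertex G -> {set vertex G}} :=
  [ffun c => if parent c v then X :&: [set z | below c z] else set0].

Definition sprout c Y := (Y == set0) || topped c Y.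

Definition sprouting v (f : {ffun vertex G -> {set vertex G}}) :=
  forall c, if parent c v then sprout c (f c) else f c == set0.

Lemma sprout_below c Y y : sprout c Y -> y \in Y -> below c y.
Proof. by case/orP => [/eqP->|]; [rewrite inE|apply: topped_below]. Qed.

Lemma graft_branches v X : topped v X -> graft v (branches v X) = X.
Proof.
move=> tX; have [vX H] := toppedP _ _ tX; apply/setP=> y; rewrite !inE.
apply/orP/idP => [[/eqP-> //|/bigcupP[c cv]]|yX].
  by rewrite ffunE cv inE => /andP[].
case: (eqVneq y v) => nyv; [by left|right].
have [c cv cy] := below_child (topped_below tX yX) nyv.
by apply/bigcupP; exists c => //; rewrite ffunE cv !inE yX.
Qed.

Lemma branch_sprout v X c : topped v X -> parent c v ->
  sprout c (X :&: [set z | below c z]).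
Proof.
move=> tX cv; have [vX H] := toppedP _ _ tX.
case: (set_0Vmem (X :&: [set z | below c z])) => [->|[y yXc]]; first by rewrite /sprout eqxx.
have up z : z \in X -> below c z -> z != c ->
    exists2 w, w \in X :&: [set z | below c z] & parent z w.
  move=> zX cz nzc; have nzv : z != v by apply: contraTneq cz => ->; apply: child_above.
  have [w wX zw] := H z zX nzv; exists w => //.
  by rewrite !inE wX (below_up cz nzc zw).
apply/orP; right; apply/toppedP; split; last by move=> z; rewrite 2!inE => /andP[]; apply: up.
have [n] := ubnP (rk y); elim: n y yXc => // n IH y; rewrite 2!inE => /andP[yX cy] ryn.
case: (eqVneq y c) => [<-|nyc]; first by rewrite !inE yX /below connect0.
have [w wXc yw] := up y yX cy nyc; apply: IH wXc _.
by apply: leq_trans (parent_rk yw) _.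
Qed.

Lemma graftK v f : sprouting v f ->
  branches v (graft v f) = f.
Proof.
move=> sf; apply/ffunP=> c; rewrite ffunE; have := sf c.
case: ifP => [cv sc|_ /eqP->//]; apply/setP=> y; rewrite !inE.
apply/andP/idP => [[]|yc]; last first.
  by split; [apply/orP; right; apply/bigcupP; exists c|apply: sprout_below yc].
case/orP=> [/eqP-> cv'|/bigcupP[d dv yd] cy]; first by case/negP: (child_above cv).
by have := sf d; rewrite dv => sd; rewrite (below_sibling cv dv cy (sprout_below sd yd)).
Qed.

Lemma graft_topped v f : sprouting v f ->
  topped v (graft v f).
Proof.
move=> sf; apply/toppedP; split; first by rewrite !inE eqxx.
move=> y; rewrite !inE => /orP[/eqP->|]; first by rewrite eqxx.
case/bigcupP=> c cv yc nyv; have := sf c; rewrite cv => /orP[/eqP e|/toppedP[cc H]].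
  by rewrite e inE in yc.
case: (eqVneq y c) => [->|nyc]; first by exists v => //; rewrite !inE eqxx.
have [z zc yz] := H y yc nyc; exists z => //.
by rewrite !inE; apply/orP; right; apply/bigcupP; exists c.
Qed.

Lemma card_graft v f : sprouting v f ->
  #|graft v f| = (\sum_(c | parent c v) #|f c|).+1.
Proof.
move=> sf; rewrite cardsU1.
have sc c y : parent c v -> y \in f c -> below c y.
  by move=> cv; have := sf c; rewrite cv; apply: sprout_below.
have -> : v \notin \bigcup_(c | parent c v) f c.
  by apply/bigcupP=> -[c cv /(sc c v cv)]; apply/negP/child_above.
rewrite -sum1_card; congr (_.+1).
under [RHS]eq_bigr do rewrite -sum1_card.
rewrite (exchange_big_dep xpredT) //= [LHS]big_mkcond /=.
apply: eq_bigr => y _; case: ifP => [/bigcupP[c cv yc]|/negP nb].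
  rewrite (big_pred1 c) // => d; apply/andP/eqP => [[dv yd]|->//].
  exact: below_sibling dv cv (sc _ _ dv yd) (sc _ _ cv yc).
by rewrite big_pred0 // => c; apply/negP=> /andP[cv yc]; apply: nb; apply/bigcupP; exists c.
Qed.

(** The choices at the children of [v] are independent, hence the product; the
    factor ['X] accounts for [v]. *)
Lemma top_gf_rec v : top_gf v = 'X * \prod_(c | parent c v) (1 + top_gf c).
Proof.
have sproutE c : 1 + top_gf c = \sum_(Y | sprout c Y) 'X^#|Y|.
  rewrite [RHS](bigD1 set0) /=; last by rewrite /sprout eqxx.
  rewrite cards0 expr0; congr (_ + _); apply: eq_bigl => Y; rewrite /sprout.
  by case: eqP => [->|] /=; rewrite ?andbT // /topped inE.
under eq_bigr do rewrite sproutE.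
rewrite (big_distr_big_dep set0) /= mulr_sumr /top_gf.
rewrite (reindex_onto (graft v) (branches v)) /=; last exact: graft_branches.
have famP f : reflect (sprouting v f)
   (f \in pfamily set0 [pred c | parent c v] (fun c => [pred Y | sprout c Y])).
  apply: (iffP pfamilyP) => [[s H] c|H].
    case: ifP => [cv|ncv]; first exact: H.
    by apply: contraFT ncv => nf; apply: (fintype.subsetP s).
  split=> [|c cv]; last by have := H c; rewrite -[parent c v]/(c \in [pred c | parent c v]) cv.
  apply/fintype.subsetP=> c nf; have := H c; rewrite [_ \in _]/=.
  by case: ifP => // _; rewrite (negPf nf).
apply: eq_big => [f|f].
  apply/andP/famP => [[tv /eqP<-] c|sf].
    by rewrite ffunE; case: (boolP (parent c v)) => [cv|]; rewrite ?eqxx //;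
      apply: branch_sprout tv cv.
  by rewrite graft_topped // graftK.
case/andP=> tv /eqP e.
have sf : sprouting v f.
  by move=> c; rewrite -e ffunE; case: (boolP (parent c v)) => [cv|]; rewrite ?eqxx //;
      apply: branch_sprout tv cv.
by rewrite card_graft // exprS prodrXr.
Qed.

End RankedForest.

(** * The generating function of a bridge *)

(** The distance from the [i]-th vertex of a path of order [2 s + 1] to its
    centre. *)
Definition offset (s i : nat) : nat := ((i - s) + (s - i))%N.

(** The bridge is rooted at the centre of the path [false]; this is the distance
    to that root, which reaches the other centre after [t.+1] steps. *)
Definition depth (s t : nat) (v : vertex (bridge s t)) : nat :=
  match v with
  | inl x => ((if x.1 then t.+1 else 0) + offset s x.2)%N
  | inr k => k.+1
  end.

(** Makes the bounds of the ordinals at hand available to [lia]. *)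
Ltac ord_bound i n :=
  lazymatch goal with
  | _ : is_true (nat_of_ord i < n)%N |- _ => fail
  | _ => have ? : (nat_of_ord i < n)%N by exact: ltn_ord
  end.

Ltac ord_bounds := repeat match goal with
  | |- context [@nat_of_ord ?n ?i] => ord_bound i n
  | _ : context [@nat_of_ord ?n ?i] |- _ => ord_bound i n
  end.

Lemma depth_adj s t (u v : vertex (bridge s t)) : adj u v -> depth u != depth v.
Proof.
case: u v => [[[] i]|k] [[[] j]|l];
  rewrite /depth /offset /= /attached /consecutive /=; ord_bounds; lia.
Qed.

Lemma depth_uniq s t (u v w : vertex (bridge s t)) : adj u v -> adj u w ->
  (depth v < depth u)%N -> (depth w < depth u)%N -> v = w.
Proof.
case: u v w => [[[] i]|k] [[[] j]|l] [[[] m]|h];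
  rewrite /depth /offset /= /attached /consecutive /=; move=> *; ord_bounds;
  try (by exfalso; lia);
  by first [congr (inl (_, _)) | congr (inr _)]; apply: val_inj => /=; lia.
Qed.

Lemma ord_eqE n (i j : 'I_n) : (i == j) = (i == j :> nat).
Proof. by []. Qed.

Definition gf s t := top_gf (@depth s t).

Lemma gf_rec s t v : gf v = 'X * \prod_(c | parent (@depth s t) c v) (1 + gf c).
Proof. exact: (top_gf_rec (@depth_uniq s t)). Qed.

(** The generating function at the top of a path of [j] further vertices put
    above a vertex whose generating function is [A]; with [A = 0] this is a bare
    path of order [j]. *)
Fixpoint chain (A : {poly rat}) (j : nat) : {poly rat} :=
  if j is j'.+1 then 'X * (1 + chain A j') else A.

(** Below a vertex of an arm hangs the part of the arm beyond it, a path of order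
    [j - 1]. *)
Lemma gf_arm s t j b (i : 'I_(2 * s + 1)) :
  i != s :> nat -> (offset s i + j)%N = s.+1 ->
  gf (inl (b, i) : vertex (bridge s t)) = chain 0 j.
Proof.
elim: j i => [|j IH] i nis; rewrite /offset => oi; ord_bounds; first lia.
rewrite gf_rec /=; congr ('X * _).
case: j IH oi => [|j] IH oi.
  clear IH; rewrite big_pred0 ?addr0 // => -[[[] m]|l];
   rewrite /parent /depth /offset /= /attached /consecutive /=;
   case: b => /=; ord_bounds; lia.
have [i' i'E] : exists i', (i < s /\ i'.+1 = i \/ s < i /\ i' = i.+1)%N.
  by exists (if (i < s)%N then i.-1 else i.+1); case: ifP; lia.
have i'P : (i' < 2 * s + 1)%N by lia.
rewrite (big_pred1 (inl (b, Ordinal i'P))) /=.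
  by congr (1 + _); apply: IH; rewrite /offset /=; lia.
clear IH.
move=> [[b' m]|l] /=; rewrite /parent /depth /offset /= /attached /consecutive /=.
  rewrite -[RHS]/((b' == b) && (m == Ordinal i'P)) ord_eqE /=.
  by case: b; case: b' => /=; ord_bounds; lia.
by rewrite -[RHS]/false; case: b => /=; ord_bounds; lia.
Qed.

Lemma center_lt s : (s < 2 * s + 1)%N. Proof. lia. Qed.
Definition center s t b : vertex (bridge s t) := inl (b, Ordinal (center_lt s)).

(** The subtrees of a path of order [2 s + 1] that contain its centre. *)
Definition star s : {poly rat} := 'X * (1 + chain 0 s) ^+ 2.

Lemma gf_center_true s t : (0 < s)%N -> gf (center s t true) = star s.
Proof.
move=> s0; rewrite gf_rec /star; congr ('X * _).
have lP : (s.-1 < 2 * s + 1)%N by lia.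
have rP : (s.+1 < 2 * s + 1)%N by lia.
rewrite (bigD1 (inl (true, Ordinal lP))) /=; last first.
  by rewrite /parent /depth /offset /= /consecutive /=; lia.
rewrite (big_pred1 (inl (true, Ordinal rP))) /=.
  by rewrite !(@gf_arm s t s) // /offset /=; lia.
move=> [[b m]|l] /=; rewrite /parent /depth /offset /= /attached /consecutive /=.
  rewrite -[RHS]/((b == true) && (m == Ordinal rP)).
  rewrite -[X in ~~ X]/((b == true) && (m == Ordinal lP)) !ord_eqE /=.
  by case: b => /=; ord_bounds; lia.
by rewrite -[RHS]/false; ord_bounds; lia.
Qed.

Lemma gf_path s t (k : 'I_t) : (0 < s)%N ->
  gf (inr k : vertex (bridge s t)) = chain (star s) (t - k).
Proof.
move=> s0; have [j] : exists j, (t - k)%N = j.+1 by exists (t - k).-1; ord_bounds; lia.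
elim: j k => [|j IH] k kj; rewrite kj gf_rec; congr ('X * _).
  rewrite (big_pred1 (center s t true)) ?gf_center_true //.
  move=> [[b m]|l] /=; rewrite /parent /depth /offset /= /attached /consecutive /=.
    rewrite -[RHS]/((b == true) && (m == Ordinal (center_lt s))) ord_eqE /=.
    by case: b => /=; ord_bounds; lia.
  by rewrite -[RHS]/false; ord_bounds; lia.
have k'P : (k.+1 < t)%N by lia.
have k'j : (t - k.+1)%N = j.+1 by lia.
rewrite (big_pred1 (inr (Ordinal k'P))) /=; first by rewrite IH /= k'j.
move=> [[b m]|l] /=; rewrite /parent /depth /offset /= /attached /consecutive /=.
  by rewrite -[RHS]/false; case: b => /=; ord_bounds; lia.
rewrite -[RHS]/(l == Ordinal k'P) ord_eqE /=.
by ord_bounds; lia.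
Qed.

Lemma gf_center_false s t : (0 < s)%N ->
  gf (center s t false) = star s * (1 + chain (star s) t).
Proof.
move=> s0; rewrite gf_rec /star -mulrA; congr ('X * _).
have lP : (s.-1 < 2 * s + 1)%N by lia.
have rP : (s.+1 < 2 * s + 1)%N by lia.
rewrite (bigD1 (inl (false, Ordinal lP))) /=; last first.
  by rewrite /parent /depth /offset /= /consecutive /=; lia.
rewrite (bigD1 (inl (false, Ordinal rP))) /=; last first.
  rewrite -[X in ~~ X]/((false == false) && (Ordinal rP == Ordinal lP)) !ord_eqE /=.
  by rewrite /parent /depth /offset /= /consecutive /=; lia.
rewrite !(@gf_arm s t s) // ?mulrA -?expr2; try by rewrite /offset /=; lia.
congr (_ * _); have [t0|t0] := posnP t.
  subst t; rewrite (big_pred1 (center s 0 true)) ?gf_center_true /star ?expr2 ?mulrA //.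
  move=> [[b m]|l] /=; last by case: l.
  rewrite /parent /depth /offset /= /attached /consecutive /=.
  rewrite -[RHS]/((b == true) && (m == Ordinal (center_lt s))).
  rewrite -[X in _ && ~~ X && _]/((b == false) && (m == Ordinal lP)).
  rewrite -[X in _ && ~~ X]/((b == false) && (m == Ordinal rP)) !ord_eqE /=.
  by case: b => /=; ord_bounds; lia.
rewrite (big_pred1 (inr (Ordinal t0))) /= ?gf_path ?subn0 /star ?expr2 ?mulrA //.
move=> [[b m]|l] /=; rewrite /parent /depth /offset /= /attached /consecutive /=.
  rewrite -[RHS]/false -[X in _ && ~~ X && _]/((b == false) && (m == Ordinal lP)).
  rewrite -[X in _ && ~~ X]/((b == false) && (m == Ordinal rP)) !ord_eqE /=.
  by case: b => /=; ord_bounds; lia.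
rewrite -[RHS]/(l == Ordinal t0) ord_eqE /=.
by ord_bounds; lia.
Qed.

(** The four arms are alike; the two centres and the connecting path give the
    remaining terms. *)
Lemma sum_gf s t : (0 < s)%N ->
  \sum_(v : vertex (bridge s t)) gf v =
    4%:R * \sum_(j < s) chain 0 j.+1 + star s
    + \sum_(j < t) chain (star s) j.+1 + star s * (1 + chain (star s) t).
Proof.
move=> s0; rewrite big_sumType /=.
have -> : \sum_(k : 'I_t) gf (inr k : vertex (bridge s t)) =
          \sum_(j < t) chain (star s) j.+1.
  rewrite [RHS](reindex_inj rev_ord_inj); apply: eq_bigr => k _.
  by rewrite gf_path //; congr chain; rewrite /=; ord_bounds; lia.
have arms b : \sum_(i : 'I_(2 * s + 1)) gf (inl (b, i) : vertex (bridge s t)) =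
    2%:R * \sum_(j < s) chain 0 j.+1 + gf (center s t b).
  rewrite (bigD1 (Ordinal (center_lt s))) //= addrC; congr (_ + _).
  pose a i := chain 0 (s.+1 - offset s i).
  transitivity (\sum_(i < 2 * s + 1 | i != s :> nat) a i).
    apply: eq_big => [i|i]; rewrite ?ord_eqE //= => ns.
    by apply: gf_arm; rewrite ?ns /offset; ord_bounds; lia.
  (* Cut at the centre; the two halves are mirror images. *)
  rewrite -(big_mkord (fun i => i != s) a) (@big_cat_nat _ _ _ s) //=; last lia.
  rewrite [X in _ + X]big_ltn_cond ?eqxx /=; last lia.
  rewrite mulr2n mulrDl !mul1r.
  congr (_ + _).
    rewrite big_nat_cond (eq_bigl (fun i => (0 <= i < s)%N)) -?big_nat;
      last by move=> i; lia.
    rewrite big_mkord; apply: eq_bigr => i _; rewrite -[RHS]/(chain 0 i.+1) /a /offset.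
    congr chain.
    by ord_bounds; lia.
  rewrite big_nat_cond (eq_bigl (fun i => (s.+1 <= i < 2 * s + 1)%N)) -?big_nat;
      last by move=> i; lia.
  rewrite -{1}[s.+1]add0n big_addn (_ : 2 * s + 1 - s.+1 = s)%N; last lia.
  rewrite big_mkord [RHS](reindex_inj rev_ord_inj); apply: eq_bigr => i _.
  rewrite -[RHS]/(chain 0 (rev_ord i).+1) /a /offset.
  by congr chain; rewrite /=; ord_bounds; lia.
have -> : \sum_(x : bool * 'I_(2 * s + 1)) gf (inl x : vertex (bridge s t)) =
    \sum_b \sum_(i : 'I_(2 * s + 1)) gf (inl (b, i) : vertex (bridge s t)).
  by rewrite pair_bigA; apply: eq_bigr => -[].
rewrite big_bool /=.
rewrite !arms gf_center_true // gf_center_false //.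
by ring.
Qed.

(** * The mean subtree order of a bridge *)

(** With [a = s + 1], the terms count the subtrees that contain both centres,
    exactly one centre, only vertices of the connecting path, and only vertices
    of one arm; [bridge_order] adds up their orders. Both are polynomials over
    the rationals rather than naturals so that the comparison of means is
    polynomial algebra. *)
Definition bridge_count (s t : rat) : rat :=
  (s + 1) ^+ 4 + 2 * (s + 1) ^+ 2 * (t + 1) + t * (t + 1) / 2 + 2 * s * (s + 1).

Definition bridge_order (s t : rat) : rat :=
  (s + 1) ^+ 4 * (2 * (s + 1) + t) + 2 * (s + 1) ^+ 3 * (t + 1)
  + (s + 1) ^+ 2 * t * (t + 1) + t * (t + 1) * (t + 2) / 6
  + 2 / 3 * s * (s + 1) * (s + 2).

Lemma mean_subtree_orderE G (p : {poly rat}) :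
  \sum_(H in subtrees G) 'X^#|H.1| = p ->
  mean_subtree_order G = p^`().[1] / p.[1].
Proof.
move=> <-; rewrite /mean_subtree_order natr_sum -sum1_card natr_sum.
rewrite raddf_sum !horner_sum; congr (_ / _); apply: eq_bigr => H _.
  by rewrite [_ 'X^_]derivXn hornerMn hornerXn expr1n.
by rewrite hornerXn expr1n.
Qed.

(** A path of order [j] has [j] subpaths through its top end, of orders
    [1], ..., [j]; an object attached at the bottom end comes with the full
    path. *)
Lemma chain_at1 A j : (chain A j).[1] = j%:R + A.[1].
Proof.
elim: j => [|j IH] /=; first by rewrite add0r.
by rewrite !hornerE IH -(natr1 j); ring.
Qed.

Lemma deriv_chain_at1 A j :
  (chain A j)^`().[1] = j%:R * (j%:R + 1) / 2 + j%:R * A.[1] + A^`().[1].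
Proof.
elim: j => [|j IH]; first by rewrite !mul0r !add0r.
rewrite /= derivM derivX mul1r derivD derivC add0r hornerD hornerM hornerX hornerD.
by rewrite IH chain_at1 hornerC -(natr1 j); field.
Qed.

Arguments chain : simpl never.

Lemma star_at1 s : (star s).[1] = (s%:R + 1) ^+ 2.
Proof.
rewrite /star hornerM hornerX horner_exp hornerD hornerC chain_at1 horner0.
ring.
Qed.

Lemma deriv_star_at1 s : (star s)^`().[1] = (s%:R + 1) ^+ 3.
Proof.
rewrite /star expr2 !(derivM, derivD, derivX, derivC).
rewrite !(hornerD, hornerM, hornerX, hornerC, horner0) chain_at1 deriv_chain_at1.
by rewrite deriv0 horner0; field.
Qed.

Lemma sum_chain_at1 A n :
  (\sum_(j < n) chain A j.+1).[1] = n%:R * (n%:R + 1) / 2 + n%:R * A.[1].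
Proof.
rewrite horner_sum; elim: n => [|n IH]; first by rewrite big_ord0 !mul0r add0r.
by rewrite big_ord_recr /= IH chain_at1 -(natr1 n); field.
Qed.

Lemma deriv_sum_chain_at1 A n :
  (\sum_(j < n) chain A j.+1)^`().[1] =
    n%:R * (n%:R + 1) * (n%:R + 2) / 6 + n%:R * (n%:R + 1) / 2 * A.[1]
    + n%:R * A^`().[1].
Proof.
rewrite raddf_sum horner_sum; elim: n => [|n IH]; first by rewrite big_ord0 !mul0r !add0r.
by rewrite big_ord_recr /= IH deriv_chain_at1 -(natr1 n); field.
Qed.

Lemma mean_bridge s t : (0 < s)%N ->
  mean_subtree_order (bridge s t) = bridge_order s%:R t%:R / bridge_count s%:R t%:R.
Proof.
move=> s0; have := sum_gf t s0; rewrite /gf /top_gf.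
rewrite -(sum_subtrees (@depth_adj s t) (@depth_uniq s t) (fun n => 'X^n : {poly rat})).
move/mean_subtree_orderE ->.
move: (star_at1 s) (deriv_star_at1 s); move: (star s) => S S1 dS1.
rewrite (_ : 4 = (4%:R)%:P) ?polyC_natr //; congr (_ / _).
  rewrite !(derivD, derivM, derivC) !(hornerD, hornerM, hornerC).
  rewrite !deriv_sum_chain_at1 !sum_chain_at1 chain_at1 deriv_chain_at1.
  by rewrite deriv0 !horner0 S1 dS1 /bridge_order; field.
rewrite !(hornerD, hornerM, hornerC) !sum_chain_at1 chain_at1 !horner0 S1.
by rewrite /bridge_count; field.
Qed.

(** * Comparing bridges with consecutive parameters *)

(** Passing from [s] to [s + 1] at fixed order shortens the connecting path from
    [u + 4] to [u]. The sign of [gain] tells which mean is larger, after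
    clearing the positive denominators. *)
Definition gain (s u : rat) : rat :=
  bridge_order (s + 1) u * bridge_count s (u + 4)
  - bridge_order s (u + 4) * bridge_count (s + 1) u.

Lemma bridge_count_gt0 (s t : rat) : 0 <= s -> 0 <= t -> 0 < bridge_count s t.
Proof.
move=> s0 t0; have s1 : 0 < s + 1 by lra.
rewrite /bridge_count -!addrA ltr_wpDr ?exprn_gt0 //.
by rewrite !addr_ge0 ?mulr_ge0 ?exprn_ge0 ?addr_ge0 // ltW.
Qed.

Lemma gain_mean (s u : nat) : (0 < s)%N ->
  (mean_subtree_order (bridge s (u + 4)) < mean_subtree_order (bridge s.+1 u))
  = (0 < gain s%:R u%:R).
Proof.
move=> s0; rewrite !mean_bridge // -[s.+1%:R]natr1 natrD.
rewrite ltr_pdivrMr ?bridge_count_gt0 ?addr_ge0 ?ler0n //.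
rewrite mulrAC ltr_pdivlMr ?bridge_count_gt0 ?addr_ge0 ?ler0n //.
by rewrite /gain subr_gt0.
Qed.

Lemma gain_mean_lt (s u : nat) : (0 < s)%N ->
  (mean_subtree_order (bridge s.+1 u) < mean_subtree_order (bridge s (u + 4)))
  = (gain s%:R u%:R < 0).
Proof.
move=> s0; rewrite !mean_bridge // -[s.+1%:R]natr1 natrD.
rewrite ltr_pdivrMr ?bridge_count_gt0 ?addr_ge0 ?ler0n //.
rewrite mulrAC ltr_pdivlMr ?bridge_count_gt0 ?addr_ge0 ?ler0n //.
by rewrite /gain subr_lt0.
Qed.

(** The expansion of [gain s u] is governed by [2 s ^ 5 u ^ 2 - 2 s ^ 8]; its only
    other negative terms are [- 16 s ^ 7] and [- 104 / 3 s ^ 6]. The hypothesis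
    lets [2 s ^ 5 u ^ 2] absorb all three. *)
Lemma gain_gt0 (s u : rat) : 0 <= s -> 0 <= u ->
  s ^+ 3 + 8 * s ^+ 2 + 18 * s <= u ^+ 2 -> 0 < gain s u.
Proof.
move=> s0 u0 h; pose x := s.
(* 36 - 104 / 3 = 4 / 3 is what the factor 18 leaves of the term in x ^ 6. *)
have -> : gain s u = 2 * x ^+ 5 * (u ^+ 2 - (x ^+ 3 + 8 * x ^+ 2 + 18 * x))
  + 4 / 3 * x ^+ 6
  + 4 / 3 * x ^+ 3 * u ^+ 3 + 2 * x ^+ 6 * u + 1 / 3 * x * u ^+ 4
  + 16 * x ^+ 4 * u ^+ 2 + 19 / 3 * x ^+ 2 * u ^+ 3 + 40 * x ^+ 5 * u
  + 1 / 6 * u ^+ 4 + 62 * x ^+ 3 * u ^+ 2 + 35 / 3 * x * u ^+ 3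
  + 634 / 3 * x ^+ 4 * u + 130 * x ^+ 2 * u ^+ 2 + 220 / 3 * x ^+ 5
  + 13 / 3 * u ^+ 3 + 1648 / 3 * x ^+ 3 * u + 401 / 3 * x * u ^+ 2
  + 1576 / 3 * x ^+ 4 + 2413 / 3 * x ^+ 2 * u + 239 / 6 * u ^+ 2
  + 1196 * x ^+ 3 + 1817 / 3 * x * u + 4348 / 3 * x ^+ 2 + 455 / 3 * u
  + 2702 / 3 * x + 196.
  by rewrite /gain /bridge_order /bridge_count /x; field.
have M i j : 0 <= x ^+ i * u ^+ j by rewrite mulr_ge0 ?exprn_ge0.
have : 0 <= x ^+ 5 * (u ^+ 2 - (x ^+ 3 + 8 * x ^+ 2 + 18 * x)).
  by rewrite mulr_ge0 ?exprn_ge0 // subr_ge0.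
move: (M 6%N 0%N) (M 3%N 3%N) (M 6%N 1%N) (M 1%N 4%N) (M 4%N 2%N) (M 2%N 3%N)
  (M 5%N 1%N) (M 0%N 4%N) (M 3%N 2%N) (M 1%N 3%N) (M 4%N 1%N) (M 2%N 2%N)
  (M 5%N 0%N) (M 0%N 3%N) (M 3%N 1%N) (M 1%N 2%N) (M 4%N 0%N) (M 2%N 1%N)
  (M 0%N 2%N) (M 3%N 0%N) (M 1%N 1%N) (M 2%N 0%N) (M 0%N 1%N) (M 1%N 0%N).
by clear; lra.
Qed.

(** In terms of [x = s + 1] the expansion is still governed by
    [2 x ^ 5 u ^ 2 - 2 x ^ 8], but now at least [16 x ^ 6 u + 32 x ^ 7] is gained
    when [x ^ 3] is bounded below by the square of [n = u + 4 x] instead of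
    [u]: the connecting path falls short of [n] by [4 x]. This beats
    the terms of the next order, which sum to at most
    [10 / 3 x ^ 6 u + 19 / 3 x ^ 7] since [u ^ 2 <= x ^ 3]; the rest is of lower
    order. *)
Lemma gain_lt0 (s u : rat) : 20 <= s + 1 -> 0 <= u ->
  (u + 4 * (s + 1)) ^+ 2 <= (s + 1) ^+ 3 -> gain s u < 0.
Proof.
move=> x20 u0 h; set x := s + 1 in x20 h.
have -> : gain s u = 2 * x ^+ 5 * u ^+ 2 - 2 * x ^+ 8 + 4 / 3 * x ^+ 3 * u ^+ 3
  + 2 * x ^+ 6 * u + 1 / 3 * x * u ^+ 4 + 6 * x ^+ 4 * u ^+ 2
  + 7 / 3 * x ^+ 2 * u ^+ 3 + 28 * x ^+ 5 * u - 1 / 6 * u ^+ 4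
  + 18 * x ^+ 3 * u ^+ 2 + 64 / 3 * x ^+ 6 + 3 * x * u ^+ 3
  + 124 / 3 * x ^+ 4 * u + 20 * x ^+ 2 * u ^+ 2 + 172 / 3 * x ^+ 5
  - 7 / 3 * u ^+ 3 + 64 * x ^+ 3 * u + 17 / 3 * x * u ^+ 2
  + 176 / 3 * x ^+ 4 + 163 / 3 * x ^+ 2 * u - 71 / 6 * u ^+ 2
  + 220 / 3 * x ^+ 3 - 37 / 3 * x * u + 40 * x ^+ 2 - 77 / 3 * u
  - 98 / 3 * x - 20.
  by rewrite /gain /bridge_order /bridge_count /x; field.
clearbody x; have x0 : 0 < x by apply: lt_le_trans x20.
have x0' := ltW x0; set P := x ^+ 3 - (u + 4 * x) ^+ 2.
have P0 : 0 <= P by rewrite subr_ge0.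
set p := x ^+ 3 - u ^+ 2.
have p0 : 0 <= p.
  rewrite subr_ge0; apply: le_trans h; rewrite ler_sqr ?nnegrE; first by lra.
  - by [].
  - by lra.
(* The certificate: multiples of P and p turn the powers of u into powers of x,
   and 20 <= x lowers degrees. *)
have M i j : 0 <= x ^+ i * u ^+ j by rewrite mulr_ge0 ?exprn_ge0.
have Mp i j : 0 <= x ^+ i * u ^+ j * p by rewrite mulr_ge0.
have Mx i j : 20 * (x ^+ i * u ^+ j) <= x ^+ i.+1 * u ^+ j.
  by rewrite exprS -mulrA ler_wpM2r.
have x2 : 0 < x ^+ 2 * u ^+ 0 by rewrite mulr1 exprn_gt0.
have MP : 0 <= x ^+ 5 * P by rewrite mulr_ge0 ?exprn_ge0.
move: (Mp 3%N 1%N) (Mp 4%N 0%N) (Mp 1%N 2%N) (Mp 2%N 1%N) (Mp 3%N 0%N) (Mp 1%N 1%N)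
  (Mp 2%N 0%N) (Mp 1%N 0%N).
move: (Mx 5%N 1%N) (Mx 4%N 1%N) (Mx 3%N 1%N) (Mx 2%N 1%N).
move: (Mx 6%N 0%N) (Mx 5%N 0%N) (Mx 4%N 0%N) (Mx 3%N 0%N) (Mx 2%N 0%N).
move: (M 0%N 4%N) (M 0%N 3%N) (M 0%N 2%N) (M 1%N 1%N) (M 2%N 1%N) x2 MP.
by rewrite /P /p; clear -u0 x0; lra.
Qed.

(** The natural number [q] measures by how much [s] stays below [n ^ (2/3)]:
    [s ^ 3 <= q / (q + 1) n ^ 2]. Then [s] is at most [n / (26 (q + 1))] for
    large [n], so that the difference between [n] and the length of the
    connecting path is negligible against the factor [q / (q + 1)]. *)
Lemma mean_increasing (q n s : nat) : (0 < s)%N -> (q.+1 * s ^ 3 <= q * n ^ 2)%N ->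
  ((26 * q.+1) ^ 3 <= n)%N ->
  admissible n s.+1 /\
  mean_subtree_order (bridge_of_order n s) < mean_subtree_order (bridge_of_order n s.+1).
Proof.
move=> s0 qs nbig.
have ms : (26 * q.+1 * s <= n)%N.
  rewrite leqNgt; apply/negP => lt.
  have : (n ^ 3 < (26 * q.+1 * s) ^ 3)%N by rewrite ltn_exp2r.
  rewrite expnMn ltnNge => /negP; apply.
  have s3 : (s ^ 3 <= n ^ 2)%N.
    by rewrite -(leq_pmul2l (ltn0Sn q)) (leq_trans qs) // leq_mul.
  by rewrite (expnS n) leq_mul.
have n8 : (8 * s <= n)%N by nia.
have adm : (4 * s.+1 <= n)%N by lia.
split; first by rewrite /admissible.
rewrite /bridge_of_order (_ : n - 4 * s = n - 4 * s.+1 + 4)%N; last by lia.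
rewrite gain_mean // gain_gt0 //.
have [u un] : exists u, n = (u + 4 * s.+1)%N by exists (n - 4 * s.+1)%N; lia.
have -> : (n - 4 * s.+1 = u)%N by lia.
have n2 : (n ^ 2 <= u ^ 2 + 16 * (n * s))%N.
  have u8 : (n <= u + 8 * s)%N by lia.
  have := leq_mul (leqnn n) u8; have := leq_mul u8 (leqnn u).
  have : (s * u <= s * n)%N by rewrite leq_mul //; lia.
  by clear; lia.
have s2 : (18 * s <= 18 * s ^ 2)%N by rewrite leq_mul // -{1}(expn1 s) leq_pexp2l.
have s26 := leq_mul (leqnn s) ms; have n26 := leq_mul (leqnn n) ms.
have h1 : (q.+1 * (s ^ 3 + 8 * s ^ 2 + 18 * s) <= q.+1 * u ^ 2)%N.
  have := leq_mul (leqnn q.+1) n2; have := leq_mul (leqnn q.+1) s2.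
  have := leq_pmull (n * s) (ltn0Sn q).
  by move: qs s26 n26; clear; lia.
have h2 : (s ^ 3 + 8 * s ^ 2 + 18 * s <= u ^ 2)%N by rewrite leq_pmul2l in h1.
by rewrite -!natrX -!natrM -!natrD ler_nat.
Qed.

(** There is no margin above [n ^ (2/3)], because the second order terms of the
    mean push its maximum below [n ^ (2/3)]. The bound on [n] forces
    [20 <= s]. *)
Lemma mean_decreasing (n s : nat) : (90 <= n)%N -> (n ^ 2 <= s ^ 3)%N -> (4 * s <= n)%N ->
  admissible n s.-1 /\
  mean_subtree_order (bridge_of_order n s) < mean_subtree_order (bridge_of_order n s.-1).
Proof.
move=> n90 ns sn; have s20 : (20 <= s)%N.
  rewrite leqNgt; apply/negP => s20.
  have : (s ^ 3 <= 19 ^ 3)%N by rewrite leq_exp2r.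
  have : (90 ^ 2 <= n ^ 2)%N by rewrite leq_exp2r.
  lia.
split; first by rewrite /admissible; lia.
case: s ns sn s20 => // s ns sn s20 /=.
rewrite /bridge_of_order (_ : n - 4 * s = n - 4 * s.+1 + 4)%N; last by lia.
rewrite gain_mean_lt; last by lia.
have [u un] : exists u, n = (u + 4 * s.+1)%N by exists (n - 4 * s.+1)%N; lia.
have -> : (n - 4 * s.+1 = u)%N by lia.
apply: gain_lt0; rewrite ?ler0n ?natr1 ?ler_nat //.
by rewrite -natrM -natrD -un -!natrX ler_nat.
Qed.

From mathcomp Require Import all_classical all_reals all_analysis.
Import numFieldNormedType.Exports.

(** * Optimal bridges *)
Lemma cube_powR23 (R : realType) (n : nat) :
  (n%:R `^ (2 / 3)) ^+ 3 = n%:R ^+ 2 :> R.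
Proof.
rewrite -powR_mulrn ?powR_ge0 // -powRrM -powR_mulrn ?ler0n //.
by congr (_ `^ _); field.
Qed.

Lemma optimal_sequence_max s n r : optimal_sequence s -> (4 <= n)%N ->
  admissible n r ->
  mean_subtree_order (bridge_of_order n r) <=
  mean_subtree_order (bridge_of_order n (s n)).
Proof. by move=> /[apply] -[_ [_ max]] ar; apply: max; exists r. Qed.

Lemma optimal_lt (R : realType) s n : optimal_sequence s -> (90 <= n)%N ->
  (s n)%:R < n%:R `^ (2 / 3) :> R.
Proof.
move=> opt n90; have n4 : (4 <= n)%N by apply: leq_trans n90.
have [/andP[_ sn] _] := opt n n4.
rewrite ltNge; apply/negP => le.
have ns : (n ^ 2 <= s n ^ 3)%N.
  by rewrite -(ler_nat R) !natrX -cube_powR23 lerXn2r ?nnegrE ?powR_ge0.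
have [adm] := mean_decreasing n90 ns sn.
by rewrite ltNge optimal_sequence_max.
Qed.

(** The natural [q] is chosen with [(q + 1) / q <= k ^ 3]. *)
Lemma optimal_gt (R : realType) (k : R) : 1 < k -> exists N : nat,
  forall s n, optimal_sequence s -> (N <= n)%N ->
    n%:R `^ (2 / 3) / k < (s n)%:R :> R.
Proof.
move=> k1; have k0 : 0 < k by apply: lt_trans k1.
have k3 : 0 < k ^+ 3 - 1 by rewrite subr_gt0 exprn_egt1.
have [q qk] : exists q : nat, q.+1%:R <= q%:R * k ^+ 3.
  exists (Num.bound (k ^+ 3 - 1)^-1).
  have := ltW (archi_boundP (ltW (etrans (invr_gt0 _) k3))).
  rewrite -div1r ler_pdivrMr // -natr1; lra.
exists ((26 * q.+1) ^ 3)%N => s n opt nbig.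
have n4 : (4 <= n)%N.
  apply: leq_trans nbig; apply: (@leq_trans (26 ^ 3)) => //.
  by rewrite leq_exp2r // leq_pmulr.
have [/andP[s0 _] _] := opt n n4.
rewrite ltNge; apply/negP; rewrite ler_pdivlMr // => le.
have qs : (q.+1 * s n ^ 3 <= q * n ^ 2)%N.
  rewrite -(ler_nat R) natrM [(q * _)%:R]natrM !natrX -cube_powR23.
  apply: (@le_trans _ _ (q%:R * ((s n)%:R * k) ^+ 3)).
    by rewrite exprMn (mulrCA q%:R) [leLHS]mulrC ler_wpM2l ?exprn_ge0.
  by rewrite ler_wpM2l // lerXn2r ?nnegrE ?powR_ge0 ?mulr_ge0 // ltW.
have [adm] := mean_increasing s0 qs nbig.
by rewrite ltNge optimal_sequence_max.
Qed.

Local Open Scope classical_set_scope.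
Local Open Scope ring_scope.
Unset Implicit Arguments.

Theorem theorem5p1 (R : realType) :
  (forall k : R, 1 < k ->
    exists N : nat, forall s : nat -> nat, optimal_sequence s ->
      forall n : nat, (N <= n)%N ->
        (n%:R `^ (2 / 3)) / k < (s n)%:R :> R /\
        (s n)%:R < n%:R `^ (2 / 3) :> R)
  /\
  (forall s : nat -> nat, optimal_sequence s ->
    (fun n : nat => (s n)%:R / (n%:R `^ (2 / 3)) : R) @ \oo --> (1 : R)).
Proof.
split=> [k k1|s opt].
  have [N HN] := optimal_gt k1; exists (maxn 90 N) => s opt n.
  by rewrite geq_max => /andP[n90 nN]; split; [exact: HN|exact: optimal_lt].
apply/cvgrPdist_lt => e e0.
have e1 : 1 < 1 + e by rewrite ltrDl.
have [N HN] := optimal_gt e1.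
exists (maxn 90 N) => // n /=; rewrite geq_max => /andP[n90 nN].
have lo := HN s n opt nN; have up := @optimal_lt R s n opt n90.
have y0 : 0 < n%:R `^ (2 / 3) :> R by apply: le_lt_trans up.
set z := (s n)%:R / _.
have z1 : z < 1 by rewrite ltr_pdivrMr ?mul1r.
have z2 : 1 < z * (1 + e).
  by rewrite /z mulrAC ltr_pdivlMr // mul1r -ltr_pdivrMr ?(lt_trans _ e1).
rewrite gtr0_norm ?subr_gt0 //.
have : z * e < e by rewrite gtr_pMl.
by move: z2; rewrite mulrDr mulr1; clear; lra.
Qed.
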